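(* There exists a simplicial complex $U$ of dimension $3$ such that $s(U)\neq s_{\mathbb{R}}(U)$.
   Context: A simplicial complex $K$ on the vertex set $[m]=\{1,\dots,m\}$ is a collection of subsets of $[m]$ (simplices) closed under taking subsets and containing $\varnothing$. Let $D^2\subset\mathbb{C}$ be the closed unit disk and $S^1=\partial D^2$. For $I\in K$ put $(D^2,S^1)^I=\{z\in (D^2)^m : |z_j|=1 \text{ for } j\notin I\}$. The moment-angle complex is $\mathcal{Z}_K=\bigcup_{I\in K}(D^2,S^1)^I\subseteq (D^2)^m$; it is preserved by the coordinatewise rotation action of the torus $T^m=(S^1)^m$. Similarly let $D^1=[-1,1]$, $S^0=\{-1,1\}$, $(D^1,S^0)^I=\{x\in (D^1)^m: x_j\in S^0 \text{ for } j\notin I\}$ and ${}_{\mathbb{R}}\mathcal{Z}_K=\bigcup_{I\in K}(D^1,S^0)^I\subseteq (D^1)^m$, with the coordinatewise sign-change action of $\mathbb{Z}_2^m$ ($\mathbb{Z}_2=\mathbb{Z}/2\mathbb{Z}$). The (ordinary) Buchstaber invariant $s(K)$ is the maximal rank of toric subgroups $G\subseteq T^m$ (closed connected subgroups isomorphic to a torus) whose restricted action on $\mathcal{Z}_K$ is free. The real Buchstaber invariant $s_{\mathbb{R}}(K)$ is the maximal rank (dimension over the field $\mathbb{Z}_2$) of subgroups $G\subseteq\mathbb{Z}_2^m$ whose restricted action on ${}_{\mathbb{R}}\mathcal{Z}_K$ is free. *)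

(* Defs.v *)
From HB Require Import structures.
From mathcomp Require Import all_boot all_order all_algebra.
From mathcomp Require Import complex.
From mathcomp Require Import all_classical all_reals all_analysis.

Set Implicit Arguments.
Unset Strict Implicit.
Unset Printing Implicit Defensive.

Import Order.TTheory GRing.Theory Num.Theory.
Import numFieldNormedType.Exports.

Local Open Scope classical_set_scope.
Local Open Scope ring_scope.
Local Open Scope complex_scope.

(* Not every singleton is required to be a simplex: ghost vertices are
   allowed. *)
Record simplicial_complex (m : nat) := SimplicialComplex {
  simplices :> {set {set 'I_m}};
  simplices0 : finset.set0 \in simplices;
  simplices_sub : forall I J : {set 'I_m},
    J \in simplices -> I \subset J -> I \in simplices }.

(* Integer-valued, so that the complex whose only simplex is the empty set has
   dimension -1. *)
Definition complex_dim (m : nat) (K : simplicial_complex m) : int :=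
  (\max_(I in simplices K) #|I|)%N%:Z - 1.

Definition is_maximum (P : nat -> Prop) (r : nat) : Prop :=
  P r /\ forall k : nat, P k -> (k <= r)%N.

(* The library puts the norm topology on every abstract numFieldType; this makes
   it available on the concrete type R[i]. *)
HB.instance Definition _ (R : realType) :=
  PseudoPointedMetric.copy R[i] (R[i])^o.

Section Complex.
Variable R : realType.

(* The matrix topology on 'rV[R[i]]_m is the product topology of C^m. *)
Definition torus (m : nat) : set 'rV[R[i]]_m :=
  [set t | forall j, `|t 0 j| = 1].

(* Group law of the torus, and also its action on C^m. *)
Definition rotate (m : nat) (t z : 'rV[R[i]]_m) : 'rV[R[i]]_m :=
  \row_j (t 0 j * z 0 j).

Definition torus_one (m : nat) : 'rV[R[i]]_m := const_mx 1.

Definition torus_inv (m : nat) (t : 'rV[R[i]]_m) : 'rV[R[i]]_m :=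
  \row_j (t 0 j)^-1.

Definition torus_subgroup (m : nat) (G : set 'rV[R[i]]_m) : Prop :=
  [/\ G `<=` @torus m, G (torus_one m),
      forall s t, G s -> G t -> G (rotate s t)
    & forall t, G t -> G (torus_inv t)].

(* [G] is isomorphic to the torus of rank [k] as a topological group, via [f]
   with inverse [g]. *)
Definition isomorphic_torus (m k : nat) (G : set 'rV[R[i]]_m) : Prop :=
  exists (f : 'rV[R[i]]_k -> 'rV[R[i]]_m) (g : 'rV[R[i]]_m -> 'rV[R[i]]_k),
    [/\ forall s t, torus s -> torus t -> f (rotate s t) = rotate (f s) (f t),
        (f @` @torus k = G) /\ (forall t, torus t -> g (f t) = t),
        {within @torus k, continuous f}
      & {within G, continuous g}].

Definition toric_subgroup (m k : nat) (G : set 'rV[R[i]]_m) : Prop :=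
  [/\ torus_subgroup G, closed G, connected G & isomorphic_torus k G].

Definition disk_circle (m : nat) (I : {set 'I_m}) : set 'rV[R[i]]_m :=
  [set z | (forall j, `|z 0 j| <= 1) /\
           (forall j, j \notin I -> `|z 0 j| = 1)].

Definition moment_angle (m : nat) (K : simplicial_complex m) :
    set 'rV[R[i]]_m :=
  \bigcup_(I in [set` simplices K]) disk_circle I.

Definition free_torus_action (m : nat) (G X : set 'rV[R[i]]_m) : Prop :=
  forall t z, G t -> X z -> rotate t z = z -> t = torus_one m.

Definition is_buchstaber (m : nat) (K : simplicial_complex m) : nat -> Prop :=
  is_maximum (fun k => exists G : set 'rV[R[i]]_m,
    toric_subgroup k G /\ free_torus_action G (moment_angle K)).

End Complex.

Section Real.
Variable R : realType.

Definition sign_change (m : nat) (e : 'rV['F_2]_m) (x : 'rV[R]_m) : 'rV[R]_m :=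
  \row_j ((-1) ^+ (e 0 j : nat) * x 0 j).

Definition interval_sphere (m : nat) (I : {set 'I_m}) : set 'rV[R]_m :=
  [set x | (forall j, -1 <= x 0 j <= 1) /\
           (forall j, j \notin I -> x 0 j = -1 \/ x 0 j = 1)].

Definition real_moment_angle (m : nat) (K : simplicial_complex m) :
    set 'rV[R]_m :=
  \bigcup_(I in [set` simplices K]) interval_sphere I.

Definition free_sign_action (m : nat) (G : {vspace 'rV['F_2]_m})
    (X : set 'rV[R]_m) : Prop :=
  forall e x, e \in G -> X x -> sign_change e x = x -> e = 0.

(* Subgroups of Z_2^m are the same thing as its F_2-linear subspaces. *)
Definition is_real_buchstaber (m : nat) (K : simplicial_complex m) :
    nat -> Prop :=
  is_maximum (fun k => exists G : {vspace 'rV['F_2]_m},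
    \dim G = k /\ free_sign_action G (real_moment_angle K)).

End Real.

(* Main.v *)
Require Import Defs.
From mathcomp Require Import all_boot all_order all_algebra.
From mathcomp Require Import complex ring lra.
From mathcomp Require Import all_classical all_reals all_analysis.

(* Take for U the complex of linearly independent sets of nonzero vectors of
   F_2^4; it has 15 vertices and dimension 3. A subgroup of Z_2^15 acts freely
   if and only if it meets the coordinate subspace of every simplex trivially.
   The kernel of the linear map F_2^15 -> F_2^4 that sends each vertex to its
   vector has this property and dimension 11, which is the largest possible
   because some simplices have four vertices.

   Given a toric subgroup of rank k that acts freely, its 3-torsion is a
   k-dimensional subspace A of F_3^15 that again meets the coordinate subspaces
   of the simplices trivially, so k <= 11. For k = 11, the quotient
   F_3^15 / A = F_3^4 would give a map from the nonzero vectors of F_2^4 to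
   F_3^4 that sends bases to bases. A finite search shows that no such map
   exists; hence s(U) <= 10 < 11. *)

Set Implicit Arguments.
Unset Strict Implicit.
Unset Printing Implicit Defensive.

Import Order.TTheory GRing.Theory Num.Theory.

Local Open Scope ring_scope.

(** * Determinants of integer matrices given by lists of rows *)

Definition drop_entry (j : nat) (s : seq int) : seq int :=
  take j s ++ drop j.+1 s.

(** Cofactor expansion along the first row. Testing for a zero entry before the recursive call keeps
    the evaluation of sparse minors cheap. *)
Fixpoint laplace (n : nat) (M : seq (seq int)) : int :=
  if n is n'.+1 then
    let term j :=
      let a := nth 0 (head [::] M) j in
      if a == 0 then 0
      else (if odd j then - a else a)
             * laplace n' (map (drop_entry j) (behead M)) in
    foldr +%R 0 (map term (index_iota 0 n))
  else 1.

Definition seq_mx (R : pzRingType) (m n : nat) (M : seq (seq int)) :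
    'M[R]_(m, n) :=
  \matrix_(i, j) (nth 0 (nth [::] M i) j)%:~R.

Lemma nth_drop_entry j k s : nth 0 (drop_entry j s) k = nth 0 s (bump j k).
Proof.
rewrite /drop_entry nth_cat size_take /bump.
case: (ltnP j (size s)) => js.
  case: (ltnP k j) => kj.
    by rewrite nth_take // leqNgt kj.
  by rewrite nth_drop addSn subnKC.
rewrite drop_oversize ?(leq_trans js) // take_oversize //.
case: (ltnP k (size s)) => ks.
  by rewrite leqNgt (leq_trans ks js).
rewrite nth_nil nth_default //.
by case: (j <= k)%N => //=; rewrite add1n ltnW.
Qed.

(** One integer computation thus settles the minors over ['F_2] and ['F_3] alike. Missing rows and
    entries read as zero on both sides. *)
Lemma det_seq_mx (R : comPzRingType) n M :
  \det (seq_mx R n n M) = (laplace n M)%:~R.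
Proof.
elim: n M => [|n IHn] M; first by rewrite det_mx00.
rewrite (expand_det_row _ ord0) -[laplace _ _]/(foldr _ _ (map _ _)).
rewrite foldrE big_map big_mkord rmorph_sum; apply: eq_bigr => j _ /=.
rewrite mxE nth0 /cofactor add0n.
case: eqP => [->|_]; first by rewrite mul0r.
have -> : (if odd j then - (head [::] M)`_j else (head [::] M)`_j)
    = (head [::] M)`_j * (-1) ^+ j.
  by rewrite -signr_odd; case: (odd j); rewrite ?mulrN1 ?mulr1.
rewrite !intrM rmorph_sign -mulrA -IHn; congr (_ * (_ * \det _)).
apply/matrixP=> i k; rewrite !mxE /=; congr (_%:~R).
case: (ltnP i (size (behead M))) => iM.
  by rewrite (nth_map [::]) // nth_drop_entry nth_behead.
rewrite [nth _ (map _ _) _]nth_default ?size_map // nth_nil.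
by rewrite -nth_behead [nth _ (behead M) _]nth_default // nth_nil.
Qed.

(** * A search for weak-map images of PG(3,2) over F_3 *)

(* The order of the points is the order in which the search places them; it
   keeps the number of partial solutions below one thousand. *)
Definition points : seq (seq int) :=
  [:: [:: 1; 0; 0; 0]; [:: 0; 1; 0; 0]; [:: 0; 0; 1; 0]; [:: 0; 0; 0; 1];
      [:: 1; 1; 1; 1]; [:: 1; 0; 0; 1]; [:: 0; 0; 1; 1]; [:: 0; 1; 0; 1];
      [:: 1; 1; 1; 0]; [:: 1; 1; 0; 1]; [:: 1; 0; 1; 1]; [:: 0; 1; 1; 1];
      [:: 0; 1; 1; 0]; [:: 1; 0; 1; 0]; [:: 1; 1; 0; 0]].

Definition minor (M : seq (seq int)) (t : seq nat) : int :=
  laplace 4 [seq nth [::] M i | i <- t].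

(** An odd minor marks a basis of F_2^4. Only bases with largest index [n] are listed, since the
    others belong to earlier stages of the search. *)
Definition bases (n : nat) : seq (seq nat) :=
  [seq t <- [seq rcons p n | p <- [seq i :: q | i <- iota 0 n,
       q <- [seq [:: j; k] | j <- iota 0 n, k <- iota 0 n]] & sorted ltn p]
     | odd `|minor points t|].

Definition trits : seq int := [:: 0; 1; -1].
Definition rows4 : seq (seq int) :=
  foldr (fun _ s => [seq x :: y | x <- trits, y <- s]) [:: [::]] (iota 0 4).

(** The default 1 makes the zero row normalized too, so that every row over F_3 has a normalized
    nonzero multiple. *)
Definition normalized (s : seq int) : bool := head 1 [seq x <- s | x != 0] == 1.

Definition candidates : seq (seq int) := [seq s <- rows4 | normalized s].

(* One filter per test, rather than one filter by all tests: [vm_compute] is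
   strict, so that [all] would not stop at the first failure. *)
Definition extensions (n : nat) (Ms : seq (seq (seq int))) :=
  foldl (fun Ms t => [seq M <- Ms | ~~ (3 %| `|minor M t|)%N])
    [seq rcons M r | M <- Ms, r <- candidates] (bases n).

(** The finite search: the first four points go to the unit vectors, points 4 to 13 are placed one
    at a time, and no partial placement survives. *)
Lemma no_extension :
  foldl (fun Ms n => extensions n Ms) [:: take 4 points] (iota 4 10) = [::].
Proof. by vm_compute. Qed.

Lemma mem_bases n t :
  t \in bases n -> size t = 4 /\ {in t, forall i, (i <= n)%N}.
Proof.
rewrite mem_filter => /andP[_ /mapP[p]].
rewrite mem_filter => /andP[_ /allpairsP[[i q] /= [i_n q_n ->]]] ->.
case/allpairsP: q_n => -[j k] /= [j_n k_n ->].
split=> // l; move: i_n j_n k_n; rewrite !mem_iota !inE /= => i_n j_n k_n.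
by case/or4P => /eqP ->; rewrite ?leqnn // ltnW.
Qed.

Lemma odd_minor n t : t \in bases n -> odd `|minor points t|.
Proof. by rewrite mem_filter => /andP[]. Qed.

Lemma Fp_intr_eq0 p (x : int) :
  prime p -> (x%:~R == 0 :> 'F_p) = (p %| `|x|)%N.
Proof. by move=> p_pr; rewrite -(dvdz_pcharf (pchar_Fp p_pr)) dvdzE. Qed.

Lemma rowsub_seq_mx (R : pzRingType) m n k (f : 'I_k -> 'I_m) M t :
  size t = k -> (forall i, f i = nth 0%N t i :> nat) ->
  rowsub f (seq_mx R m n M) = seq_mx R k n [seq nth [::] M i | i <- t].
Proof.
move=> size_t ft; apply/matrixP => i j; rewrite !mxE ft.
by rewrite (nth_map 0%N) ?size_t.
Qed.

Lemma det_rowsub_scale (R : comPzRingType) m n (d : 'rV[R]_m)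
    (M : 'M[R]_(m, n)) (f : 'I_n -> 'I_m) :
  \det (rowsub f (diag_mx d *m M)) = (\prod_i d 0 (f i)) * \det (rowsub f M).
Proof.
have -> : rowsub f (diag_mx d *m M) = diag_mx (\row_i d 0 (f i)) *m rowsub f M.
  by apply/matrixP => i j; rewrite !mul_diag_mx !mxE.
rewrite det_mulmx det_diag; congr (_ * _).
by apply: eq_bigr => i _; rewrite mxE.
Qed.

Definition trit (a : 'F_3) : int :=
  if a == 0 then 0 else if a == 1 then 1 else -1.

Lemma trit_in a : trit a \in trits.
Proof. by rewrite /trit; case: eqP => // _; case: eqP. Qed.

Lemma tritK a : (trit a)%:~R = a.
Proof. by case: a => [[|[|[|//]]]] lt_a; apply/val_inj. Qed.

Lemma mem_rows4 s : size s = 4 -> {subset s <= trits} -> s \in rows4.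
Proof.
case: s => [|x [|y [|z [|t []]]]] //= _ s_trits.
by do 4 (apply: allpairs_f; [by apply: s_trits; rewrite !inE eqxx ?orbT|]).
Qed.

Lemma normalize_rows4 :
  all (fun s => has (fun e : int => map ( *%R e) s \in candidates) [:: 1; -1])
    rows4.
Proof. by vm_compute. Qed.

Lemma row_candidate (r : 'rV['F_3]_4) :
  exists s : 'F_3 * seq int, [/\ s.1 != 0, s.2 \in candidates &
    forall j : 'I_4, (nth 0 s.2 j)%:~R = s.1 * r 0 j].
Proof.
pose x := [seq trit (r 0 j) | j <- enum 'I_4].
have size_x : size x = 4 by rewrite size_map size_enum_ord.
have : x \in rows4.
  by apply: mem_rows4 => // _ /mapP[j _ ->]; apply: trit_in.
move/(allP normalize_rows4)/hasP => [e e_unit ex].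
exists (e%:~R, map ( *%R e) x); split=> // [|j].
  by move: e_unit; rewrite !inE => /orP[] /eqP ->.
rewrite (nth_map 0) ?size_x // (nth_map j) ?size_enum_ord //.
by rewrite nth_ord_enum intrM tritK.
Qed.

Lemma mem_extensions n Ms M r :
  M \in Ms -> r \in candidates ->
  {in bases n, forall t, ~~ (3 %| `|minor (rcons M r) t|)%N} ->
  rcons M r \in extensions n Ms.
Proof.
move=> M_Ms r_cand; rewrite /extensions.
have: rcons M r \in [seq rcons M r | M <- Ms, r <- candidates].
  exact: allpairs_f.
move: [seq rcons M r | M <- Ms, r <- candidates] => Ms'.
elim: (bases n) Ms' => //= t ts IHts Ms' M_Ms' nz; apply: IHts.
  by rewrite mem_filter M_Ms' nz ?mem_head.
by move=> u u_ts; apply: nz; rewrite inE u_ts orbT.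
Qed.

(** If no binary basis became dependent over F_3, every prefix of [R] would survive the search,
    contrary to [no_extension]. *)
Lemma no_candidate_matrix (R : seq (seq int)) :
  size R = 15 -> take 4 R = take 4 points -> {subset R <= candidates} ->
  exists f : 'I_4 -> 'I_15,
    \det (rowsub f (seq_mx 'F_2 15 4 points)) != 0 /\
    \det (rowsub f (seq_mx 'F_3 15 4 R)) = 0.
Proof.
move=> size_R R4 R_cand; apply: contrapT => noF.
suff step k : (k <= 10)%N -> take (4 + k) R \in
    foldl (fun Ms n => extensions n Ms) [:: take 4 points] (iota 4 k).
  by have := step 10%N isT; rewrite no_extension.
elim: k => [|k IHk] k_le; first by rewrite R4 inE.
rewrite -[k.+1]addn1 iotaD foldl_cat /= addnA addn1.
have lt_R : (4 + k < 15)%N by rewrite (ltn_add2l 4 k 11) (leq_trans k_le).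
rewrite (take_nth [::]) ?size_R //; apply: mem_extensions.
- by rewrite IHk // ltnW.
- by rewrite R_cand // mem_nth // size_R.
move=> t t_basis; have [size_t t_le] := mem_bases t_basis.
rewrite -(take_nth [::]) ?size_R //.
(* The indices in [t] are at most [4 + k], so the minor sees only this prefix. *)
have -> : minor (take (4 + k).+1 R) t = minor R t.
  congr (laplace 4 _); apply/eq_in_map => i /t_le i_le.
  by rewrite nth_take.
apply/negP => dvd3; apply: noF.
exists (fun i => inord (nth 0%N t i)).
have lt15 (i : 'I_4) : (nth 0 t i < 15)%N.
  have /t_le : nth 0%N t i \in t by rewrite mem_nth ?size_t.
  by move/leq_ltn_trans; apply.
rewrite !(@rowsub_seq_mx _ _ _ _ _ _ t) // => [|i|i]; rewrite ?inordK //.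
rewrite !det_seq_mx Fp_intr_eq0 // dvdn2 negbK (odd_minor t_basis); split=> //.
by apply/eqP; rewrite Fp_intr_eq0.
Qed.

Lemma unit_points (i : 'I_4) :
  nth [::] points i \in candidates /\
  forall j : 'I_4, (nth 0 (nth [::] points i) j)%:~R = (i == j)%:R :> 'F_3.
Proof.
case: i => [[|[|[|[|//]]]] ?]; split=> // -[[|[|[|[|//]]]] ?]; exact/val_inj.
Qed.

Lemma det_unit_points :
  \det (rowsub (widen_ord (isT : (4 <= 15)%N)) (seq_mx 'F_2 15 4 points)) != 0.
Proof.
rewrite (@rowsub_seq_mx _ _ _ _ _ _ [:: 0; 1; 2; 3]%N) //; last first.
  by case=> [[|[|[|[|//]]]]].
by rewrite det_seq_mx Fp_intr_eq0.
Qed.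

Lemma no_ternary_lift (M : 'M['F_3]_(15, 4)) :
  exists f : 'I_4 -> 'I_15,
    \det (rowsub f (seq_mx 'F_2 15 4 points)) != 0 /\ \det (rowsub f M) = 0.
Proof.
apply: contrapT => noF.
pose b : 'I_4 -> 'I_15 := widen_ord (isT : (4 <= 15)%N).
have unitB : rowsub b M \in unitmx.
  rewrite unitmxE unitfE; apply/eqP => det0; apply: noF; exists b; split=> //.
  exact: det_unit_points.
(* Changing the basis and rescaling rows by units affects no vanishing of
   minors, so that the rows may be taken among the candidates. *)
pose N := M *m invmx (rowsub b M).
have N_base i j : N (b i) j = (i == j)%:R.
  have -> : N (b i) j = rowsub b N i j by rewrite [RHS]mxE.
  by rewrite -mul_rowsub_mx mulmxV // mxE.
have /choice[s s_row] i := row_candidate (row i N).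
(* The search starts from the literal list [take 4 points], so the first four rows, already unit
   vectors in [N], keep the scalar 1. *)
pose p i := if (i < 4)%N then (1, nth [::] points i) else s (inord i).
have p_row (i : 'I_15) : [/\ (p i).1 != 0, (p i).2 \in candidates &
    forall j : 'I_4, (nth 0 (p i).2 j)%:~R = (p i).1 * N i j].
  rewrite /p; case: ltnP => [i_lt | _]; last first.
    rewrite inord_val; have [? ? sE] := s_row i.
    by split=> // j; rewrite sE mxE.
  have -> : i = b (Ordinal i_lt) by apply: val_inj.
  have [? pE] := unit_points (Ordinal i_lt).
  by split=> //= j; rewrite N_base mul1r -pE.
have [|||f [det2 det3]] := @no_candidate_matrix [seq (p i).2 | i <- iota 0 15].
- by rewrite size_map size_iota.
- by [].
- move=> _ /mapP[i i15 ->]; move: i15; rewrite mem_iota => /andP[_ i15].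
  by case: (p_row (Ordinal i15)).
apply: noF; exists f; split=> //.
have defN : seq_mx 'F_3 15 4 [seq (p i).2 | i <- iota 0 15]
    = diag_mx (\row_(i < 15) (p i).1) *m N.
  apply/matrixP => i j; rewrite mul_diag_mx mxE [RHS]mxE [X in X * _]mxE.
  rewrite (nth_map 0%N) ?size_iota // nth_iota // add0n.
  by case: (p_row i) => _ _ ->.
(* The vanishing minor is a product of nonzero scalars, a minor of [M] and the determinant of an
   inverse; only the minor of [M] can be zero. *)
move/eqP: det3; rewrite defN det_rowsub_scale mulf_eq0.
case/orP => [/prodf_eq0[i _]|].
  by rewrite mxE; case: (p_row (f i)) => /negbTE ->.
rewrite -mul_rowsub_mx det_mulmx mulf_eq0 => /orP[/eqP //|].
by move: unitB; rewrite det_inv invr_eq0 unitmxE unitfE => /negbTE ->.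
Qed.

(** * The complex of independent sets of rows of a matrix *)

Definition supported (F : nmodType) (m : nat) (I : {set 'I_m}) (c : 'rV[F]_m) :
    bool :=
  [forall j, (j \notin I) ==> (c 0 j == 0)].

Lemma supportedP (F : nmodType) m (I : {set 'I_m}) (c : 'rV[F]_m) :
  reflect (forall j, j \notin I -> c 0 j = 0) (supported I c).
Proof.
apply: (iffP 'forall_implyP) => c0 j j_I; first exact/eqP/c0.
by rewrite c0.
Qed.

(** The coordinate subspace of [I] has dimension [#|I|] and meets the row space of [A] trivially, so
    the two dimensions add up inside F^m. *)
Lemma rank_add_card_le (F : fieldType) k m (A : 'M[F]_(k, m)) (I : {set 'I_m}) :
  (forall c : 'rV_m, supported I c -> (c <= A)%MS -> c = 0) ->
  (\rank A + #|I| <= m)%N.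
Proof.
move=> A_I; pose E : 'M[F]_(#|I|, m) := rowsub enum_val 1%:M.
have E_supp c : (c <= E)%MS -> supported I c.
  case/submxP => d ->; apply/supportedP => j j_I; rewrite mxE big1 // => i _.
  rewrite !mxE; case: eqP => [ij|]; last by rewrite mulr0.
  by rewrite -ij enum_valP in j_I.
have freeE : row_free E.
  apply/row_freeP; exists E^T; apply/matrixP => i j.
  rewrite mxE (bigD1 (enum_val i)) //= !mxE eqxx mul1r big1 ?addr0.
    by rewrite (inj_eq enum_val_inj) eq_sym.
  by move=> l /negbTE l_i; rewrite !mxE eq_sym l_i mul0r.
rewrite -(eqP freeE) -mxrank_disjoint_sum ?rank_leq_col //.
apply/eqP/rowV0P => c; rewrite sub_capmx => /andP[c_A c_E].
by apply: A_I => //; apply: E_supp.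
Qed.

Section RowComplex.
Variables (F : finFieldType) (m n : nat) (W : 'M[F]_(m, n)).

(** Stated as trivial intersection of the kernel of [W] with a coordinate subspace, the same form as
    the freeness criteria below. *)
Definition row_independent (I : {set 'I_m}) : bool :=
  [forall c : 'rV[F]_m, supported I c && (c *m W == 0) ==> (c == 0)].

Lemma row_independentP I :
  reflect (forall c : 'rV[F]_m, supported I c -> c *m W = 0 -> c = 0)
          (row_independent I).
Proof.
apply: (iffP 'forall_implyP) => W_I c.
  by move=> cI /eqP cW; apply/eqP/W_I/andP.
by case/andP => cI /eqP cW; rewrite (W_I c).
Qed.

Lemma row_independent0 : finset.set0 \in [set I | row_independent I].
Proof.
rewrite inE; apply/row_independentP => c /supportedP c0 _.
by apply/rowP => j; rewrite c0 ?inE // mxE.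
Qed.

Lemma row_independent_sub (I J : {set 'I_m}) :
  J \in [set I | row_independent I] -> I \subset J ->
  I \in [set I | row_independent I].
Proof.
rewrite !inE => /row_independentP W_J /fintype.subsetP IJ.
apply/row_independentP => c /supportedP c0.
apply: W_J; apply/supportedP => j j_J.
by apply: c0; apply: contra j_J; apply: IJ.
Qed.

Definition row_complex : simplicial_complex m :=
  SimplicialComplex row_independent0 row_independent_sub.

End RowComplex.

Lemma det_rowsub_inj (R : comPzRingType) m n (W : 'M[R]_(m, n))
    (f : 'I_n -> 'I_m) :
  \det (rowsub f W) != 0 -> injective f.
Proof.
move=> detW i j fij; apply: contraNeq detW => ij; apply/eqP.
by apply: (determinant_alternate ij) => k; rewrite !mxE fij.
Qed.

(** A relation supported on the image of [f] pulls back to a relation among the rows of an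
    invertible matrix. *)
Lemma mem_row_complex_image (F : finFieldType) m n (W : 'M[F]_(m, n))
    (f : 'I_n -> 'I_m) :
  \det (rowsub f W) != 0 -> [set f i | i : 'I_n] \in row_complex W.
Proof.
move=> detW; rewrite inE; apply/row_independentP => c /supportedP c0 cW.
have unitW : rowsub f W \in unitmx by rewrite unitmxE unitfE.
have f_inj := det_rowsub_inj detW.
pose d := \row_i c 0 (f i).
have dW : d *m rowsub f W = 0.
  rewrite -cW; apply/rowP => j; rewrite !mxE.
  rewrite (bigID (mem [set f i | i : 'I_n])) /= [X in _ = _ + X]big1 ?addr0.
    rewrite big_imset /=; last by move=> i k _ _; apply: f_inj.
    by apply: eq_big => [i|i _]; rewrite ?inE // !mxE.
  by move=> k k_f; rewrite c0 ?mul0r.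
have d0 : d = 0 by rewrite -(mulmxK unitW d) dW mul0mx.
apply/rowP => k.
have [/imsetP[i _ ->]|k_f] := boolP (k \in [set f i | i : 'I_n]).
  by have /rowP/(_ i) := d0; rewrite !mxE.
by rewrite c0 // mxE.
Qed.

(** Conversely, a vector killed by the square matrix pushes forward along the injective [f] to a
    relation supported on its image. *)
Lemma det_rowsub_neq0 (F : fieldType) m n (M : 'M[F]_(m, n))
    (f : 'I_n -> 'I_m) :
  injective f ->
  (forall c : 'rV_m, supported [set f i | i : 'I_n] c -> c *m M = 0 -> c = 0) ->
  \det (rowsub f M) != 0.
Proof.
move=> f_inj M_f; apply/det0P => -[d d_nz dM].
pose c := \row_k \sum_(i | f i == k) d 0 i.
have cf i : c 0 (f i) = d 0 i.
  rewrite mxE (big_pred1 i) // => j; exact: inj_eq.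
have c0 k : k \notin [set f i | i : 'I_n] -> c 0 k = 0.
  move=> k_f; rewrite mxE big_pred0 // => i; apply/negP => /eqP fik.
  by case/negP: k_f; rewrite -fik imset_f.
have c_eq0 : c = 0.
  apply: M_f; first exact/supportedP.
  rewrite -dM; apply/rowP => j; rewrite !mxE.
  rewrite (bigID (mem [set f i | i : 'I_n])) /= [X in _ + X]big1 ?addr0.
    rewrite big_imset /=; last by move=> i k _ _; apply: f_inj.
    by apply: eq_big => [i|i _]; rewrite ?inE // cf !mxE.
  by move=> k k_f; rewrite c0 ?mul0r.
by case/eqP: d_nz; apply/rowP => i; rewrite -cf c_eq0 !mxE.
Qed.

Lemma card_row_complex_le (F : finFieldType) m n (W : 'M[F]_(m, n))
    (I : {set 'I_m}) :
  I \in row_complex W -> (#|I| <= n)%N.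
Proof.
rewrite inE => /row_independentP W_I.
have : (\rank (kermx W) + #|I| <= m)%N.
  by apply: rank_add_card_le => c cI /sub_kermxP; apply: W_I.
rewrite mxrank_ker -leq_subRL ?leq_subr // subKn ?rank_leq_row //.
by move/leq_trans; apply; apply: rank_leq_col.
Qed.

(** * The universal complex of F_2^4 *)

Definition universal_complex : simplicial_complex 15 :=
  row_complex (seq_mx 'F_2 15 4 points).

Lemma universal_facet :
  exists2 I : {set 'I_15}, I \in universal_complex & #|I| = 4%N.
Proof.
have detW := det_unit_points.
exists [set widen_ord (isT : (4 <= 15)%N) i | i : 'I_4].
  exact: mem_row_complex_image.
by rewrite card_imset ?card_ord //; apply: det_rowsub_inj detW.
Qed.

Lemma universal_dim : complex_dim universal_complex = 3.
Proof.
rewrite /complex_dim.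
suff -> : (\max_(I in universal_complex) #|I|)%N = 4%N by [].
have [I I_U cardI] := universal_facet; apply/anti_leq/andP; split.
  by apply/bigmax_leqP => J; apply: card_row_complex_le.
by apply: (bigop.bigmax_sup I); rewrite ?cardI.
Qed.

Lemma ternary_rank_le k (P : 'M['F_3]_(k, 15)) :
  (forall I, I \in universal_complex -> forall c : 'rV_15, supported I c ->
     (c <= P)%MS -> c = 0) -> (\rank P <= 10)%N.
Proof.
move=> P_U; rewrite leqNgt; apply/negP => rankP.
have [I I_U cardI] := universal_facet.
have := rank_add_card_le (P_U I I_U); rewrite cardI addn4 => rankP_le.
have rankP11 : \rank P = 11%N by apply/eqP; rewrite eqn_leq rankP -ltnS andbT.
have [M kerM] : exists M : 'M['F_3]_(15, 4),
    forall c : 'rV_15, c *m M = 0 -> (c <= P)%MS.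
  have : \rank (cokermx P) = 4%N by rewrite mxrank_coker rankP11.
  (* The left factor of a full-rank factorization of [cokermx P] serves as [M]. Its width is a rank,
     so it is generalized before that rank becomes 4. *)
  move: (col_base _) (row_base (cokermx P)) (mulmx_base (cokermx P)).
  move=> M N defP r4.
  move: M N defP; rewrite r4 => M N defP; exists M => c cM.
  by rewrite submxE -defP mulmxA cM mul0mx.
have [f [detW detM]] := no_ternary_lift M.
(* A relation among the selected rows of [M] lies in [P] and is supported on a simplex, hence is
   zero. *)
suff : \det (rowsub f M) != 0 by rewrite detM eqxx.
apply: det_rowsub_neq0 => [|c cI /kerM]; first exact: det_rowsub_inj detW.
by apply: P_U cI; apply: mem_row_complex_image.
Qed.

(** * The real Buchstaber invariant *)

(** A sign change fixes a point exactly when it is supported on the zero coordinates of that point,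
    and these lie in a simplex. The point with zeros exactly on [I] gives the converse. *)
Lemma free_sign_actionP (R : realType) m (K : simplicial_complex m)
    (G : {vspace 'rV['F_2]_m}) :
  free_sign_action G (@real_moment_angle R m K) <->
  (forall I, I \in simplices K -> forall e, supported I e -> e \in G -> e = 0).
Proof.
split=> [freeG I I_K e /supportedP e_I eG | freeG e x eG [I I_K [_ x_I]] ex].
  apply: (freeG e (\row_j (j \notin I)%:R)) => //.
    exists I => //; split=> j.
      by rewrite mxE; case: (j \notin I) => /=; lra.
    by move=> j_I; right; rewrite mxE j_I.
  apply/rowP => j; rewrite !mxE; case: (boolP (j \in I)) => [|/e_I ->].
    by rewrite mulr0.
  by rewrite mul1r.
apply: (freeG I) => //; apply/supportedP => j /x_I xj.
have {ex} : (-1) ^+ (e 0 j : nat) * x 0 j = x 0 j.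
  by have /rowP/(_ j) := ex; rewrite mxE.
case: (e 0 j) => [[|[|//]]] lt_e /=; first by move=> _; apply/val_inj.
by rewrite expr1 => xE; exfalso; case: xj xE => ->; lra.
Qed.

Lemma universal_real_buchstaber (R : realType) :
  is_real_buchstaber R universal_complex 11.
Proof.
have dim_le G :
    free_sign_action G (@real_moment_angle R 15 universal_complex) ->
    (\dim G <= 11)%N.
  move/free_sign_actionP => freeG.
  (* A basis of [G] as rows, so that the rank bound for a facet of four vertices applies. *)
  pose B : 'M['F_2]_(\dim G, 15) := \matrix_(i < \dim G) (vbasis G)`_i.
  have BE (d : 'rV_(\dim G)) : d *m B = \sum_i d 0 i *: (vbasis G)`_i.
    by rewrite mulmx_sum_row; apply: eq_bigr => i _; rewrite rowK.
  have freeB : row_free B.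
    apply: inj_row_free => d; rewrite BE => d0; apply/rowP => i; rewrite mxE.
    by have /freeP/(_ (fun i => d 0 i))/(_ d0 i) := basis_free (vbasisP G).
  have [I I_U cardI] := universal_facet.
  suff : (\rank B + #|I| <= 15)%N by rewrite cardI (eqP freeB) addn4.
  apply: rank_add_card_le => c cI /submxP[d cE]; apply: freeG cI _ => //.
  rewrite cE BE; apply: memv_suml => i _; rewrite memvZ // vbasis_mem //.
  by rewrite mem_nth // size_tuple.
split=> [|_ [G [<-]]]; last exact: dim_le.
pose W := seq_mx 'F_2 15 4 points.
pose h : 'Hom('rV['F_2]_15, 'rV['F_2]_4) := linfun (mulmxr W).
have lkerE c : (c \in lker h) = (c *m W == 0) by rewrite memv_ker lfunE.
have freeK :
    free_sign_action (lker h) (@real_moment_angle R 15 universal_complex).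
  apply/free_sign_actionP => I; rewrite inE => /row_independentP W_I c cI.
  by rewrite lkerE => /eqP; apply: W_I.
exists (lker h); split=> //; apply/anti_leq; rewrite dim_le //=.
(* By rank-nullity the kernel has dimension at least 15 - 4. *)
have dim_limg : (\dim (limg h) <= 4)%N.
  by rewrite (leq_trans (dimvS (subvf _))) // dimvf.
have dimV : \dim {:'rV['F_2]_15} = 15 by rewrite dimvf.
have := limg_ker_dim h fullv; rewrite capfv dimV => dimh.
rewrite -(leq_add2r 4).
apply: (@leq_trans (\dim (lker h) + \dim (limg h))); first by rewrite dimh.
by rewrite leq_add2l.
Qed.

(** * Free toric subgroups and their 3-torsion *)

Local Open Scope classical_set_scope.
Local Open Scope complex_scope.

Lemma free_torus_action_supported (R : realType) m (K : simplicial_complex m)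
    (G : set 'rV[R[i]]_m) I t :
  free_torus_action G (moment_angle K) -> I \in simplices K -> G t ->
  (forall j, j \notin I -> t 0 j = 1) -> t = torus_one R m.
Proof.
move=> freeG I_K Gt t1; apply: (freeG t (\row_j (j \notin I)%:R)) => //.
  exists I => //; split=> j; rewrite mxE; last by move=> ->; rewrite normr1.
  by case: (j \notin I); rewrite /= ?normr1 ?normr0 ?ler01.
apply/rowP => j; rewrite !mxE; case: (boolP (j \in I)) => [|/t1 ->].
  by rewrite mulr0.
by rewrite mul1r.
Qed.

Lemma exists_primitive_cube_root (C : numClosedFieldType) :
  exists w : C, 3.-primitive_root w.
Proof.
have /closed_rootP[w] : size (\poly_(i < 3) 1 : {poly C}) != 1%N.
  by rewrite size_poly_eq ?oner_neq0.
rewrite /root horner_poly !big_ord_recr big_ord0 /= !mul1r add0r expr0 expr1.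
move=> /eqP w0; have w3 : w ^+ 3 = 1.
  apply/eqP; rewrite -subr_eq0; apply/eqP.
  have -> : w ^+ 3 - 1 = (w - 1) * (1 + w + w ^+ 2) by ring.
  by rewrite w0 mulr0.
exists w; have [//|k w_k k3] := prim_order_exists _ w3.
have /primeP[_ /(_ k k3)/pred2P[k1|<- //]] : prime 3 by [].
(* Order 1 would turn 1 + w + w^2 = 0 into 3 = 0. *)
have w1 : w = 1 by rewrite -[w]expr1 -k1 (prim_expr_order w_k).
have : 3%:R != 0 :> C by rewrite pnatr_eq0.
by rewrite -w0 w1 expr1n => /eqP[]; ring.
Qed.

Section CubeRoots.
Variables (R : realType) (w : R[i]).
Hypothesis w_prim : 3.-primitive_root w.

(** The identification of F_3^m with the 3-torsion of the torus T^m. *)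
Definition cube_char (m : nat) (x : 'rV['F_3]_m) : 'rV[R[i]]_m :=
  \row_j w ^+ (x 0 j).

Lemma cube_char_torus m (x : 'rV_m) : torus (cube_char x).
Proof.
move=> j; rewrite mxE; apply/eqP; rewrite -(@pexpr_eq1 _ _ 3) // -normrX.
by rewrite exprAC (prim_expr_order w_prim) expr1n normr1.
Qed.

Lemma cube_charD m (x y : 'rV_m) :
  cube_char (x + y) = rotate (cube_char x) (cube_char y).
Proof.
apply/rowP => j; rewrite !mxE -exprD /=.
by rewrite -[RHS](expr_mod _ (prim_expr_order w_prim)).
Qed.

Lemma cube_char0 m : cube_char (0 : 'rV_m) = torus_one R m.
Proof. by apply/rowP => j; rewrite !mxE expr0. Qed.

Lemma cube_char_inj m : injective (@cube_char m).
Proof.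
move=> x y /rowP xy; apply/rowP => j; have /eqP := xy j.
rewrite !mxE (eq_prim_root_expr w_prim) !modn_small ?ltn_ord //.
by move/eqP/val_inj.
Qed.

Lemma cube_char_surj m (t : 'rV_m) :
  (forall j, t 0 j ^+ 3 = 1) -> exists x, cube_char x = t.
Proof.
move=> t3; exists (\row_j (sval (prim_rootP w_prim (t3 j)) : 'F_3)).
by apply/rowP => j; rewrite !mxE; case: prim_rootP.
Qed.

End CubeRoots.

(** Over a prime field every scalar is a natural multiple of 1, so additive maps are linear. *)
Lemma additive_F3_mulmx k m (phi : 'rV['F_3]_k -> 'rV['F_3]_m) :
  {morph phi : x y / x + y} -> exists P, forall x, phi x = x *m P.
Proof.
move=> phiD; have phi0 : phi 0 = 0.
  by apply: (addrI (phi 0)); rewrite -phiD !addr0.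
have phiZ a x : phi (a *: x) = a *: phi x.
  rewrite -[a]natr_Zp !scaler_nat; elim: (nat_of_ord a) => [|n IHn].
    by rewrite !mulr0n.
  by rewrite !mulrS phiD IHn.
exists (\matrix_i phi (delta_mx 0 i)) => x.
rewrite [in LHS](row_sum_delta x) (big_morph phi phiD phi0) mulmx_sum_row.
by apply: eq_bigr => i _; rewrite phiZ rowK.
Qed.

(** On 3-torsion the isomorphism [f] becomes an injective linear map from F_3^k to F_3^m. Its matrix
    is [P], and the row space of [P] encodes elements of [G], to which freeness applies. *)
Lemma free_toric_ternary (R : realType) m (K : simplicial_complex m) k
    (G : set 'rV[R[i]]_m) :
  toric_subgroup k G -> free_torus_action G (moment_angle K) ->
  exists2 P : 'M['F_3]_(k, m), row_free P &
    forall I, I \in simplices K -> forall c : 'rV_m, supported I c ->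
      (c <= P)%MS -> c = 0.
Proof.
move=> [[G_torus _ _ _] _ _ [f [g [fD [fG gf] _ _]]]] freeG.
have [w w_prim] := exists_primitive_cube_root R[i].
have torus1 : torus (torus_one R k) by move=> j; rewrite mxE normr1.
have rotate1 n : rotate (torus_one R n) (torus_one R n) = torus_one R n.
  by apply/rowP => j; rewrite !mxE mulr1.
have Gf t : torus t -> G (f t) by move=> Tt; rewrite -fG; exists t.
(* The image of the unit is idempotent, and its coordinates have modulus 1, hence can be
   cancelled. *)
have f1 : f (torus_one R k) = torus_one R m.
  apply/rowP => j; have := fD _ _ torus1 torus1; rewrite rotate1.
  move/rowP/(_ j); rewrite !mxE => /eqP; rewrite eq_sym -subr_eq0.
  rewrite -{3}[f _ 0 j]mulr1 -mulrBr mulf_eq0 subr_eq0 => /orP[|/eqP //].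
  by rewrite -normr_eq0 (G_torus _ (Gf _ torus1)) oner_eq0.
have Ex_torus x := @cube_char_torus R w w_prim k x.
have /choice[phi phiE] x : exists y, cube_char w y = f (cube_char w x).
  apply: (cube_char_surj w_prim) => j.
  have : f (cube_char w (x + (x + x))) = torus_one R m.
    rewrite (_ : x + (x + x) = 0) ?cube_char0 //.
    by rewrite -!mulr2n -mulrS -scaler_nat pchar_Zp ?scale0r.
  rewrite !(cube_charD w_prim) !fD //; last by rewrite -cube_charD.
  by move/rowP/(_ j); rewrite !mxE exprS expr2.
have phiD : {morph phi : x y / x + y}.
  move=> x y; apply: (cube_char_inj w_prim).
  by rewrite (cube_charD w_prim) !phiE (cube_charD w_prim) fD.
have phi_f_eq1 x : f (cube_char w x) = torus_one R m -> x = 0.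
  move=> fx1; apply: (cube_char_inj w_prim).
  by rewrite -[LHS]gf // fx1 -f1 gf // cube_char0.
have [P phiP] := additive_F3_mulmx phiD; exists P.
  apply: inj_row_free => x; rewrite -phiP => phix; apply: phi_f_eq1.
  by rewrite -phiE phix cube_char0.
move=> I I_K c /supportedP c_I /submxP[x cE].
(* Here [c] is [phi x], and freeness makes [f] trivial at [cube_char w x], so [x = 0]. *)
suff -> : c = phi 0 by apply: (addrI (phi 0)); rewrite -phiD !addr0.
rewrite cE -phiP; congr phi; apply: phi_f_eq1.
apply: (free_torus_action_supported freeG I_K); first exact: Gf.
by move=> j /c_I cj; rewrite -phiE phiP -cE mxE cj expr0.
Qed.

(** The torus of rank 0 is a point; this makes the set of ranks of free toric subgroups nonempty. *)
Lemma trivial_toric_subgroup (R : realType) m :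
  toric_subgroup 0 [set torus_one R m].
Proof.
have rotate1 : rotate (torus_one R m) (torus_one R m) = torus_one R m.
  by apply/rowP => j; rewrite !mxE mulr1.
split.
- split=> [_ -> j|//|s t -> ->//|_ ->]; first by rewrite mxE normr1.
  by apply/rowP => j; rewrite !mxE invr1.
- exact/accessible_closed_set1/hausdorff_accessible/norm_hausdorff.
- move=> B [x Bx] [C _ BE] _; move: Bx; rewrite BE => -[-> Cx].
  by apply/seteqP; split=> [y []|y ->].
exists (fun=> torus_one R m), (fun=> 0); split=> //.
- split; last by move=> t _; apply/rowP; case.
  apply/seteqP; split=> [_ [t _ <-]//|_ ->]; exists 0 => // j.
  by have := ltn_ord j; rewrite ltn0.
- exact/continuous_subspaceT/cst_continuous.
- exact/continuous_subspaceT/cst_continuous.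
Qed.

(** * Existence of the maximal rank and comparison of the invariants *)

Lemma bounded_maximum (P : nat -> Prop) n :
  (exists k, P k) -> (forall k, P k -> (k <= n)%N) -> exists r, is_maximum P r.
Proof.
move=> [k Pk] P_le.
have exP : exists k, `[< P k >] by exists k; apply/asboolP.
have leP i : `[< P i >] -> (i <= n)%N by move/asboolP/P_le.
case: (ex_maxnP exP leP) => r /asboolP Pr r_max; exists r; split=> // i Pi.
by apply: r_max; apply/asboolP.
Qed.

Theorem theorem1 (R : realType) :
  exists (m : nat) (U : simplicial_complex m) (s sR : nat),
    [/\ complex_dim U = 3, is_buchstaber R U s, is_real_buchstaber R U sR
      & s <> sR].
Proof.
have s_le k : (exists G : set 'rV[R[i]]_15,
    toric_subgroup k G /\
    free_torus_action G (moment_angle universal_complex)) ->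
    (k <= 10)%N.
  move=> [G [toricG freeG]].
  have [P freeP P_U] := free_toric_ternary toricG freeG.
  by rewrite -(eqP freeP); apply: ternary_rank_le.
(* The exact value of [s] is left open: a maximum exists and is at most 10, which separates it from
   11. *)
have [|s s_max] := bounded_maximum _ s_le.
  exists 0%N, [set torus_one R 15]; split; first exact: trivial_toric_subgroup.
  by move=> t z ->.
exists 15%N, universal_complex, s, 11%N; split=> //.
- exact: universal_dim.
- exact: universal_real_buchstaber.
- by move=> s11; have := s_le s s_max.1; rewrite s11.
Qed.
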